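(* Let $D\in\mathbb N$, $(\alpha_n)_{n\in\mathbb N_0}\subseteq[0,1]$, $(\gamma_n)_{n\in\mathbb N_0}\subseteq[0,\infty)$, let $(\Omega,\mathcal F,\mathbb P)$ be a probability space, for every $n\in\mathbb N_0$ let $\mathfrak G_n\colon\mathbb R^D\times\Omega\to\mathbb R^D$ be measurable, and let $\mathbf m\colon\mathbb N_0\times\Omega\to\mathbb R^D$ and $\Theta\colon\mathbb N_0\times\Omega\to\mathbb R^D$ satisfy for all $n\in\mathbb N_0$ that $\mathbf m_0=0$, $$\mathbf m_{n+1}=\alpha_n\mathbf m_n+(1-\alpha_n)\mathfrak G_n(\Theta_n),\qquad\text{and}\qquad\Theta_{n+1}=\Theta_n-\gamma_n\mathbf m_{n+1}.$$ Then there exist functions $\Phi_n=(\Phi_n^1,\dots,\Phi_n^D)\colon(\mathbb R^D)^{n+1}\to\mathbb R^D$, $n\in\mathbb N_0$, which satisfy for all $n\in\mathbb N_0$ that $$\Theta_{n+1}=\Theta_n-\Phi_n(\mathfrak G_0(\Theta_0),\mathfrak G_1(\Theta_1),\dots,\mathfrak G_n(\Theta_n))$$ and which satisfy for all $n\in\mathbb N_0$, $G=((G_{i,j})_{j\in\{1,\dots,D\}})_{i\in\{0,1,\dots,n\}}\in(\mathbb R^D)^{n+1}$, $j\in\{1,\dots,D\}$ with $\sum_{i=0}^n|G_{i,j}|=0$ that $\Phi_n^j(G)=0$.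
   Context: $\mathfrak G_n(\Theta_n)$ denotes the function $\omega\mapsto\mathfrak G_n(\Theta_n(\omega),\omega)$. *)

(* Defs.v *)
From HB Require Import structures.
From mathcomp Require Import all_boot all_order all_algebra.
From mathcomp Require Import all_classical all_reals all_analysis.
Set Implicit Arguments.
Unset Strict Implicit.
Unset Printing Implicit Defensive.
Import Order.TTheory GRing.Theory Num.Theory.
Import numFieldNormedType.Exports.
Local Open Scope classical_set_scope.
Local Open Scope ring_scope.

(* MathComp-Analysis has no measurable structure on matrices: equip 'M[R]_(m, n),
   and hence 'rV[R]_D as R^D, with the Borel sigma-algebra. *)
Section borel_matrix.
Context (R : realType) (m n : nat).

HB.instance Definition _ :=
  @isMeasurable.Build (sigma_display (@open 'M[R]_(m, n))) 'M[R]_(m, n)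
    <<s @open 'M[R]_(m, n) >>
    (@sigma_algebra0 _ setT _)
    (@sigma_algebraC _ _)
    (@sigma_algebra_bigcup _ setT _).

End borel_matrix.

(* Main.v *)
(* Unrolling the momentum recursion gives
   m_n = sum_(i < n) (1 - alpha_i) (prod_(i < k < n) alpha_k) G_i(Theta_i), so
   gamma_n m_(n+1) is a fixed linear combination of the observed gradients; it
   acts coordinatewise, whence it vanishes in any coordinate in which all the
   gradients vanish. *)

Require Import Defs.
From HB Require Import structures.
From mathcomp Require Import all_boot all_order all_algebra.
From mathcomp Require Import all_classical all_reals all_analysis.
Import Order.TTheory GRing.Theory Num.Theory.
Import numFieldNormedType.Exports.
Local Open Scope classical_set_scope.
Local Open Scope ring_scope.

(** Induction on [n]: scaling by [alpha n] appends one factor to each product, and the new term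
    [g n] enters with an empty product. *)
Lemma momentum_closed_form (R : comNzRingType) (V : lmodType R)
    (alpha : nat -> R) (g m : nat -> V) :
  m 0%N = 0 ->
  (forall n, m n.+1 = alpha n *: m n + (1 - alpha n) *: g n) ->
  forall n, m n =
    \sum_(i < n) ((1 - alpha i) * \prod_(i.+1 <= k < n) alpha k) *: g i.
Proof.
move=> m0 mS; elim=> [|n IHn]; first by rewrite big_ord0.
rewrite mS IHn big_ord_recr /= big_geq // mulr1 scaler_sumr; congr (_ + _).
apply: eq_bigr => i _.
by rewrite scalerA big_nat_recr ?ltn_ord //= mulrCA (mulrC (alpha n)).
Qed.

Theorem lemma4p8 (R : realType) (D : nat) (D_gt0 : (0 < D)%N)
    (alpha gamma : nat -> R)
    (alpha01 : forall n, 0 <= alpha n <= 1)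
    (gamma_ge0 : forall n, 0 <= gamma n)
    (d : measure_display) (Omega : measurableType d) (P : probability Omega R)
    (G : nat -> 'rV[R]_D * Omega -> 'rV[R]_D)
    (measurable_G : forall n, measurable_fun setT (G n))
    (m Theta : nat -> Omega -> 'rV[R]_D)
    (m0 : forall w, m 0%N w = 0)
    (mS : forall n w,
      m n.+1 w = alpha n *: m n w + (1 - alpha n) *: G n (Theta n w, w))
    (ThetaS : forall n w, Theta n.+1 w = Theta n w - gamma n *: m n.+1 w) :
  exists Phi : forall n : nat, 'M[R]_(n.+1, D) -> 'rV[R]_D,
    (forall n w,
       Theta n.+1 w =
       Theta n w - Phi n (\matrix_(i < n.+1) G i (Theta i w, w))) /\
    (forall n (g : 'M[R]_(n.+1, D)) (j : 'I_D),
       \sum_(i < n.+1) `|g i j| = 0 -> Phi n g 0 j = 0).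
Proof.
pose c n (i : nat) := (1 - alpha i) * \prod_(i.+1 <= k < n) alpha k.
(* The weights are [c n.+1], not [c n]: step [n] uses the already updated momentum. *)
exists (fun n g => gamma n *: \sum_(i < n.+1) c n.+1 i *: row i g).
split=> [n w|n g j /eqP].
  rewrite ThetaS.
  (* The closed form is applied at fixed [w]; its weights do not depend on [w]. *)
  rewrite (momentum_closed_form _ _ _ _ (m ^~ w) (m0 w) (mS ^~ w)).
  by congr (_ - _ *: _); apply: eq_bigr => i _; rewrite rowK.
(* A zero sum of nonnegative terms forces every [g i j] to vanish, hence every summand in coordinate
   [j]. *)
rewrite psumr_eq0 => [/allP g0|i _]; last exact: normr_ge0.
rewrite mxE summxE big1 ?mulr0 // => i _; rewrite !mxE.
by have := g0 i (mem_index_enum i); rewrite normr_eq0 => /eqP ->; rewrite mulr0.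
Qed.
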